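(* If a dynamical system $(X,T)$ is uniformly rigid, then every point in $X$ is multi-recurrent.
   Context: A (topological) dynamical system $(X,T)$ consists of a (nonempty) compact metric space $(X,\rho)$ and a continuous map $T\colon X\to X$. $\mathbb{N}$ is the set of positive integers. $(X,T)$ is uniformly rigid if for every $\varepsilon>0$ there exists $n\in\mathbb{N}$ such that $\rho(T^nx,x)<\varepsilon$ for all $x\in X$. A point $x\in X$ is multi-recurrent if for every $d\ge 1$ there exists a strictly increasing sequence $\{n_k\}_{k=1}^\infty$ in $\mathbb{N}$ such that $T^{in_k}x\to x$ as $k\to\infty$ for each $i=1,2,\dots,d$. *)

(* Defs.v *)
From mathcomp Require Import all_boot all_order all_algebra.
From mathcomp Require Import all_classical all_reals all_analysis.

Set Implicit Arguments.
Unset Strict Implicit.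
Unset Printing Implicit Defensive.

Import Order.TTheory GRing.Theory Num.Theory.
Import numFieldNormedType.Exports.

Local Open Scope classical_set_scope.
Local Open Scope ring_scope.

(* Times are positive integers, so positivity is required of the elements of
   [nat] used below. *)

Definition dynamical_system (R : realType) (X : metricType R) (T : X -> X)
    : Prop :=
  [/\ [set: X] !=set0, compact [set: X] & continuous T].

Definition uniformly_rigid (R : realType) (X : metricType R) (T : X -> X)
    : Prop :=
  forall e : R, 0 < e ->
    exists2 n : nat, (0 < n)%N & forall x : X, mdist (iter n T x) x < e.

(* The sequence [n_] is indexed from 0 instead of 1. *)
Definition multi_recurrent (R : realType) (X : metricType R) (T : X -> X)
    (x : X) : Prop :=
  forall d : nat, (1 <= d)%N ->
    exists n_ : nat -> nat,
      [/\ forall k, (0 < n_ k)%N,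
          {homo n_ : k l / (k < l)%N} &
          forall i : nat, (1 <= i <= d)%N ->
            (fun k => iter (i * n_ k) T x) @ \oo --> x].

(* Main.v *)
Require Import Defs.
From mathcomp Require Import all_boot all_order all_algebra.
From mathcomp Require Import all_classical all_reals all_analysis.

Import Order.TTheory GRing.Theory Num.Theory.
Local Open Scope ring_scope.

(** A time [n] at which [T^n] is uniformly [delta]-close to the identity yields
    many others: [T^(m n)] is a product of [m] maps, each of which moves every
    point by less than [delta], so by the triangle inequality it moves every
    point by at most [m delta] ([mdist_iter_le]).  Because the bound on the
    displacement holds at all points, it applies at each point that the orbit
    visits, and no continuity estimate is called for.  Choosing [delta] small
    against both [d] and a prescribed lower bound [N], and replacing [n] by its
    multiple [N.+1 * n], gives an arbitrarily large time [t] such that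
    [T^t, T^(2t), ..., T^(dt)] are all close to the identity
    ([uniformly_rigid_large_time]).  Picking such times recursively, each above
    its predecessor and with closeness [1/(k+1)], produces the sequence; the
    same one serves every point. *)

(** The displacements of [f] along an orbit add up. *)
Lemma mdist_iter_le (R : realType) (X : metricType R) (f : X -> X) (e : R)
    (fe : forall x, mdist (f x) x <= e) (m : nat) (x : X) :
  mdist (iter m f x) x <= e *+ m.
Proof.
elim: m => [|m IHm] /=; first by rewrite mdistxx mulr0n.
rewrite mulrS; apply: le_trans (metric_triangle _ (iter m f x) _) _.
exact: lerD.
Qed.

(** Rigidity by itself provides some positive time, possibly the same one for
    every [e]; passing to a multiple makes the time exceed [N]. *)
Lemma uniformly_rigid_large_time (R : realType) (X : metricType R) (T : X -> X)
    (Trigid : uniformly_rigid T) (d N : nat) (e : R) (e0 : 0 < e) :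
  exists2 t : nat, (N < t)%N &
    forall (i : nat) (x : X), (i <= d)%N -> mdist (iter (i * t) T x) x < e.
Proof.
(* [T^(i t)] is a power of [T^n] with exponent [i * N.+1 <= d * N.+1]; the
   extra successor makes the resulting bound strict. *)
pose D := (d * N.+1).+1.
have delta0 : 0 < e / D%:R by rewrite divr_gt0// ltr0n.
have [n n0 nT] := Trigid _ delta0.
exists (N.+1 * n)%N => [|i x id]; first exact: leq_pmulr.
rewrite mulnA iterM.
apply: le_lt_trans (mdist_iter_le _ _ _ _ (fun y => ltW (nT y)) _ _) _.
rewrite -[_ / _ *+ _]mulr_natr mulrAC ltr_pdivrMr ?ltr0n// ltr_pM2l// ltr_nat.
by rewrite ltnS leq_mul2r id orbT.
Qed.

Theorem lemma3p4 (R : realType) (X : metricType R) (T : X -> X)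
  (hT : dynamical_system T) (hrigid : uniformly_rigid T) :
  forall x : X, multi_recurrent T x.
Proof.
move=> x d _.
have /choice[t tP] (p : nat * nat) : exists t : nat, (p.2 < t)%N /\
    forall (i : nat) (y : X), (i <= d)%N ->
      mdist (iter (i * t) T y) y < p.1.+1%:R^-1.
  have p0 : 0 < p.1.+1%:R^-1 :> R by rewrite invr_gt0 ltr0n.
  by have [t] := uniformly_rigid_large_time _ _ _ hrigid d p.2 _ p0; exists t.
(* The value at [0] is a start for the recursion, so the recurrence times are
   the values from index [1] on. *)
pose s := fix s k := if k is k'.+1 then t (k', s k') else 0%N.
have s_lt k : (s k < s k.+1)%N by have [] := tP (k, s k).
exists (fun k => s k.+1); split=> [k|k l kl|i /andP[_ id]].
- exact: leq_ltn_trans (s_lt k).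
- by apply: (homo_ltn ltn_trans s_lt); rewrite ltnS.
- apply/cvg_ballP => e e0.
  have := near_infty_natSinv_lt (PosNum e0); apply: filterS => k ke.
  rewrite ballEmdist/= metric_sym.
  by have [_ /(_ i x id)] := tP (k, s k); move/lt_trans; apply.
Qed.
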